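(* Let $\theta \in (0,1) \cap \mathbb{Q}$, and let $w = w(n)$ be a positive real-valued function of the positive integer $n$ with $w(n) = O(n^{1/3})$. There is a constant $C > 0$ such that, for all sufficiently large $n$, every $w(n)$-bounded $\theta$-intersecting family $\mathcal{F}$ over $[n]$ satisfies $|\mathcal{F}| \leq C n$.
   Context: Write $[n] = \{1,\dots,n\}$. A family over $[n]$ is a set of (distinct) subsets of $[n]$. For $\theta \in (0,1)\cap\mathbb{Q}$, a (fractional) $\theta$-intersecting family over $[n]$ is a collection $\mathcal{F}$ of nonempty subsets of $[n]$ such that for all $A, B \in \mathcal{F}$ with $A \neq B$ we have $|A \cap B| \in \{\theta |A|, \theta |B|\}$. For a positive real $w$, a family of sets is $w$-bounded if every set in the family has size at most $w$. *)

(* Defs.v *)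
From mathcomp Require Import all_boot all_order all_algebra.
From mathcomp Require Import all_classical all_reals all_analysis.

Set Implicit Arguments.
Unset Strict Implicit.
Unset Printing Implicit Defensive.

Import Order.TTheory GRing.Theory Num.Theory.
Local Open Scope ring_scope.

(* The ground set [n] = {1, ..., n} is encoded by 'I_n = {0, ..., n-1}. *)
Definition theta_intersecting (theta : rat) (n : nat) (F : {set {set 'I_n}})
    : Prop :=
  (forall A : {set 'I_n}, A \in F -> A != finset.set0) /\
  (forall A B : {set 'I_n}, A \in F -> B \in F -> A != B ->
     #|A :&: B|%:R = theta * #|A|%:R \/ #|A :&: B|%:R = theta * #|B|%:R).

Definition bounded_family (R : realType) (w : R) (n : nat)
    (F : {set {set 'I_n}}) : Prop :=
  forall A : {set 'I_n}, A \in F -> #|A|%:R <= w.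

(* Main.v *)
(* Split the family into layers F_k of k-sets, and let m bound all sizes.  Layers
   with at most 4 m^2 members contribute O(m^3) = O(n) in total.  A layer with
   more members is a sunflower (a weak form of Deza's theorem) whose kernel has
   theta k elements, and the kernels of these layers form a chain.  If two sets
   of sizes j < k from such layers share a point outside their kernels, they
   share more than theta j points, hence exactly theta k, so theta k <= j.  Thus
   the petals through a given point v have distinct sizes within a factor
   1 / theta of each other; spreading a unit charge per set evenly
   over its petal, every v receives at most 1 / (theta (1 - theta)). *)
Require Import Defs.
From mathcomp Require Import all_boot all_order all_algebra.
From mathcomp Require Import all_classical all_reals all_analysis.
From mathcomp Require Import zify ring lra.
Import Order.TTheory GRing.Theory Num.Theory.
Import numFieldNormedType.Exports.
Local Open Scope ring_scope.

Set Implicit Arguments.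
Unset Strict Implicit.

(** * Uniform families with constant pairwise intersections *)

Section Uniform.
Variables (T : finType) (G : {set {set T}}) (k l : nat).
Hypothesis card_k : forall A, A \in G -> #|A| = k.
Hypothesis card_l :
  forall A B, A \in G -> B \in G -> A != B -> #|A :&: B| = l.

Definition degree x := #|[set A : {set T} in G | x \in A]|.

Lemma degree_le x : (degree x <= #|G|)%N.
Proof. by apply/subset_leq_card/fintype.subsetP => A; rewrite inE => /andP[]. Qed.

Lemma degreeC x : #|[set A : {set T} in G | x \notin A]| = (#|G| - degree x)%N.
Proof.
have := cardsID [set A : {set T} | x \in A] G.
rewrite /degree.
have -> : G :&: [set A : {set T} | x \in A] = [set A : {set T} in G | x \in A].
  by apply/setP => A; rewrite !inE.
have -> : G :\: [set A : {set T} | x \in A] = [set A : {set T} in G | x \notin A].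
  by apply/setP => A; rewrite !inE andbC.
by move=> <-; rewrite addKn.
Qed.

Lemma sum_if_mem x (a b : rat) :
  \sum_(A in G) (if x \in A then a else b) =
  (degree x)%:R * a + (#|G| - degree x)%:R * b.
Proof.
rewrite (bigID (fun A : {set T} => x \in A)) /=; congr (_ + _).
  rewrite (eq_bigr (fun=> a)); last by move=> A /andP[_ ->].
  rewrite sumr_const mulr_natl; congr (_ *+ _).
  by apply: eq_card => A; rewrite !inE.
rewrite (eq_bigr (fun=> b)); last by move=> A /andP[_ /negbTE ->].
rewrite sumr_const mulr_natl -degreeC; congr (_ *+ _).
by apply: eq_card => A; rewrite !inE.
Qed.

(** Expanding the square and summing over [y] first gives [f A * f B] the coefficient [#|A :&: B|],
    which is [k] on the diagonal and [l] off it. *)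
Lemma sum_sq_weights (f : {set T} -> rat) :
  \sum_y (\sum_(A in G) f A * (y \in A)%:R) ^+ 2 =
  l%:R * (\sum_(A in G) f A) ^+ 2 + (k%:R - l%:R) * \sum_(A in G) f A ^+ 2.
Proof.
transitivity (\sum_(A in G) \sum_(B in G) f A * f B * #|A :&: B|%:R).
  under eq_bigr do rewrite expr2 big_distrlr /=.
  rewrite exchange_big /=; apply: eq_bigr => A _.
  rewrite exchange_big /=; apply: eq_bigr => B _.
  rewrite -sum1_card natr_sum mulr_sumr [RHS]big_mkcond /=; apply: eq_bigr => y _.
  by rewrite inE; case: (y \in A); case: (y \in B); rewrite /= ?mulr1 ?mulr0 ?mul0r.
rewrite [X in l%:R * X]expr2 big_distrlr /= !mulr_sumr -big_split /=.
apply: eq_bigr => A AG.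
rewrite (bigD1 A) //= finset.setIid (card_k AG) [in RHS](bigD1 A) //=.
rewrite (eq_bigr (fun B => l%:R * (f A * f B))); last first.
  by move=> B /andP[BG BA]; rewrite card_l 1?eq_sym// mulrC.
by rewrite -mulr_sumr; ring.
Qed.

(* Bound the [x] term of [sum_sq_weights] by the whole sum, with weights [N - d]
   on the sets through [x] and [- d] on the others, which add up to 0. *)
Lemma degree_codegree_le x :
  (degree x * (#|G| - degree x) <= k * #|G|)%N.
Proof.
set d := degree x; set e := (#|G| - d)%N.
have Nde : #|G| = (d + e)%N by rewrite subnKC// degree_le.
pose f (A : {set T}) : rat := if x \in A then e%:R else - d%:R.
have sumf : \sum_(A in G) f A = 0.
  by rewrite /f sum_if_mem -/d -/e mulrN mulrC subrr.
have sumf2 : \sum_(A in G) f A ^+ 2 = d%:R * e%:R ^+ 2 + e%:R * d%:R ^+ 2.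
  rewrite -(sqrrN d%:R) -sum_if_mem; apply: eq_bigr => A _.
  by rewrite /f; case: ifP.
have sumfx : \sum_(A in G) f A * (x \in A)%:R = d%:R * e%:R.
  rewrite -[RHS]addr0 -[X in _ + X](mulr0 e%:R) -sum_if_mem.
  by apply: eq_bigr => A _; rewrite /f; case: ifP; rewrite ?mulr1 ?mulr0.
have := sum_sq_weights f.
rewrite sumf sumf2 (bigD1 x) //= sumfx.
move=> E.
(* Both discarded quantities, [S] and [l * d * e * (d + e)], are nonnegative; cancelling [d * e]
   then leaves the claim. *)
have : (d%:R * e%:R) ^+ 2 <= k%:R * (d%:R * e%:R * (d%:R + e%:R)) :> rat.
  have s0 : 0 <= \sum_(i | i != x) (\sum_(A in G) f A * (i \in A)%:R) ^+ 2.
    by apply: sumr_ge0 => i _; apply: sqr_ge0.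
  have : 0 <= l%:R * (d%:R * e%:R * (d%:R + e%:R)) :> rat.
    by rewrite !mulr_ge0 ?addr_ge0.
  move: E s0; set S := \sum_(i | _) _; nra.
rewrite Nde -natrD -!natrM -natrX ler_nat.
case: (posnP (d * e)) => [->//|de0].
by rewrite -mulnn [X in (_ <= X)%N -> _]mulnCA leq_pmul2l.
Qed.

Lemma sum_degree (S : {set T}) :
  (\sum_(x in S) degree x = \sum_(A in G) #|A :&: S|)%N.
Proof.
transitivity (\sum_(x in S) \sum_(A in G) (x \in A : nat))%N; last first.
  rewrite exchange_big /=; apply: eq_bigr => A _.
  rewrite -sum1_card big_mkcond [RHS]big_mkcond /=; apply: eq_bigr => x _.
  by rewrite inE; case: (x \in A); case: (x \in S).
apply: eq_bigr => x _; rewrite /degree -sum1_card [RHS]big_mkcond [LHS]big_mkcond /=.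
by apply: eq_bigr => A _; rewrite inE; case: (A \in G); case: (x \in A).
Qed.

Lemma sum_degree_block A : A \in G ->
  (\sum_(x in A) degree x = k + l * #|G|.-1)%N.
Proof.
move=> AG; rewrite sum_degree (bigD1 A) //= finset.setIid (card_k AG).
rewrite (eq_bigr (fun=> l)); last by move=> B /andP[BG BA]; apply: card_l.
congr addn; rewrite sum_nat_const mulnC; congr muln.
rewrite (cardsD1 A) AG /=.
by apply: eq_card => B; rewrite !inE andbC.
Qed.

(* By [degree_codegree_le] every point is of degree at most [2k] or misses at
   most [2k] sets; the kernel consists of the points of the second kind. *)
Lemma sunflower : (0 < k)%N -> (4 * k ^ 2 < #|G|)%N ->
  exists2 K : {set T}, #|K| = l & forall A, A \in G -> K \subset A.
Proof.
move=> k0 kG.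
pose K := [set x | #|G| - degree x <= 2 * k]%N.
(* If both the degree and its complement exceeded [2 * k], the larger would be at least half of
   [#|G|] and their product would exceed [k * #|G|]. *)
have degP x : x \notin K -> (degree x <= 2 * k)%N.
  rewrite inE -ltnNge => xK.
  have := degree_codegree_le x; have := degree_le x.
  nia.
have degK x : x \in K -> (#|G| <= degree x + 2 * k)%N.
  by rewrite inE; lia.
have [A0 A0G] : exists A, A \in G by apply/finset.set0Pn; rewrite -card_gt0; lia.
have lk : (l < k)%N.
  have [B] : exists B, B \in G :\ A0.
    by apply/finset.set0Pn; rewrite -card_gt0; move: kG; rewrite (cardsD1 A0) A0G; nia.
  rewrite !inE => /andP[BA BG].
  rewrite ltnNge; apply: contra (BA) => kl.
  have AB : A0 \subset B.
    apply/finset.setIidPl/eqP; rewrite eqEcard subsetIl.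
    by rewrite [X in (_ <= X)%N]card_l ?card_k 1?eq_sym.
  by rewrite eq_sym eqEcard AB (card_k A0G) (card_k BG) /=.
(* The degrees over [A] total [k + l * (#|G| - 1)]. Points of [K] contribute almost [#|G|] each and
   the others little, so [#|A :&: K| * #|G|] is within [3 * k ^ 2 < #|G|] of [l * #|G|]. *)
have AK A : A \in G -> #|A :&: K| = l.
  move=> AG; have := sum_degree_block AG.
  rewrite (bigID (fun x => x \in K)) /= => E.
  have cD : (#|A :&: K| + #|A :\: K| = k)%N by rewrite cardsID card_k.
  have lo : (#|A :&: K| * (#|G| - 2 * k) <= \sum_(x in A | x \in K) degree x)%N.
    rewrite -sum_nat_const big_mkcond [leqRHS]big_mkcond /=.
    apply: leq_sum => x _; rewrite finset.in_setI; case: ifP => // /andP[_ xK].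
    by rewrite leq_subLR addnC degK.
  have up : (\sum_(x in A | x \in K) degree x <= #|A :&: K| * #|G|)%N.
    rewrite -sum_nat_const big_mkcond [leqRHS]big_mkcond /=.
    by apply: leq_sum => x _; rewrite finset.in_setI; case: ifP => // _; apply: degree_le.
  have up' : (\sum_(x in A | x \notin K) degree x <= #|A :\: K| * (2 * k))%N.
    rewrite -sum_nat_const big_mkcond [leqRHS]big_mkcond /=.
    apply: leq_sum => x _; rewrite finset.in_setD andbC; case: ifP => // /andP[xK _].
    exact: degP.
  have cb : (#|A :\: K| * (2 * k) <= 2 * k ^ 2)%N.
    by rewrite mulnCA expnS expn1 leq_mul2l leq_mul2r -cD leq_addl orbT.
  have ab : (#|A :&: K| * (2 * k) <= 2 * k ^ 2)%N.
    by rewrite mulnCA expnS expn1 leq_mul2l leq_mul2r -cD leq_addr orbT.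
  have kk : (k <= k ^ 2)%N by rewrite expnS expn1 leq_pmulr.
  have N1 : (l * #|G| = l * #|G|.-1 + l)%N by rewrite -mulnSr prednK //; lia.
  move: lo; rewrite mulnBr => lo.
  apply/eqP; rewrite eqn_leq leqNgt [(l <= _)%N]leqNgt.
  apply/andP; split; apply/negP => al.
    have : (l.+1 * #|G| <= #|A :&: K| * #|G|)%N by rewrite leq_mul2r al orbT.
    rewrite mulSn; move: E lo up up' cb ab kk N1 kG lk; clear.
    by move: #|G| #|A :&: K| => N a; lia.
  have : (#|A :&: K|.+1 * #|G| <= l * #|G|)%N by rewrite leq_mul2r al orbT.
  rewrite mulSn; move: E lo up up' cb ab kk N1 kG lk; clear.
  by move: #|G| #|A :&: K| => N a; lia.
(* Over [K] the degrees total [#|G| * l] and each is at least [#|G| - 2 * k]; with [l + 1] points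
   this would force [#|G| <= 2 * k ^ 2]. *)
have Kl : (#|K| <= l)%N.
  have dK : (\sum_(x in K) degree x = #|G| * l)%N.
    by rewrite sum_degree (eq_bigr (fun=> l)) ?sum_nat_const.
  have : (#|K| * (#|G| - 2 * k) <= \sum_(x in K) degree x)%N.
    rewrite -sum_nat_const; apply: leq_sum => x xK.
    by rewrite leq_subLR addnC degK.
  rewrite dK => lo; rewrite leqNgt; apply/negP => lK.
  have : (l.+1 * (#|G| - 2 * k) <= #|G| * l)%N.
    by apply: leq_trans lo; rewrite leq_mul2r lK orbT.
  have : (l.+1 * (2 * k) <= 2 * k ^ 2)%N.
    by rewrite mulnCA expnS expn1 leq_mul2l leq_mul2r lk orbT.
  rewrite mulnBr mulSn [(#|G| * l)%N]mulnC; move: kG; clear.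
  by move: #|G| => N; lia.
have KA A : A \in G -> A :&: K = K.
  by move=> AG; apply/eqP; rewrite eqEcard subsetIr /= AK.
exists K; last by move=> A /KA <-; apply: subsetIl.
by rewrite -(KA _ A0G) AK.
Qed.

End Uniform.

(** * Layers of a theta-intersecting family and their kernels *)

Section ThetaIntersecting.
Variables (theta : rat) (n m : nat) (F : {set {set 'I_n}}).
Hypothesis theta_gt0 : 0 < theta.
Hypothesis theta_lt1 : theta < 1.
Hypothesis F_theta : theta_intersecting theta F.
Hypothesis F_le : forall A, A \in F -> (#|A| <= m)%N.

Definition layer (k : nat) := [set A : {set 'I_n} in F | #|A| == k].

(** The threshold involves [m] rather than [k]: [sunflower] then applies to every big layer, and
    such a layer outnumbers the points of any member of [F]. *)
Definition big k := (4 * m ^ 2 < #|layer k|)%N.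

Definition kernel k := \bigcap_(A in layer k) A.

Lemma layerP k A : reflect (A \in F /\ #|A| = k) (A \in layer k).
Proof. by rewrite inE; apply: (iffP andP) => -[? /eqP]. Qed.

Lemma layer_le k A : A \in layer k -> (k <= m)%N.
Proof. by case/layerP => /F_le + <-. Qed.

Lemma layer_gt0 k A : A \in layer k -> (0 < k)%N.
Proof. by case/layerP => AF <-; rewrite card_gt0; exact: F_theta.1. Qed.

Lemma card_setI_layer k A B : A \in layer k -> B \in layer k -> A != B ->
  #|A :&: B|%:R = theta * k%:R.
Proof.
move=> /layerP[AF Ak] /layerP[BF Bk] AB.
by case: (F_theta.2 A B AF BF AB) => ->; rewrite ?Ak ?Bk.
Qed.

(** The core from [sunflower] lies in every member, hence in [kernel k], which lies in [A :&: B];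
    the core and [A :&: B] have equal size, so all three coincide. *)
Lemma setI_layer k A B : big k -> A \in layer k -> B \in layer k -> A != B ->
  A :&: B = kernel k.
Proof.
move=> bk Ak Bk AB.
have layer_card C : C \in layer k -> #|C| = k by case/layerP.
have layer_cardI C D : C \in layer k -> D \in layer k -> C != D ->
    #|C :&: D| = #|A :&: B|.
  move=> Ck Dk CD; apply/eqP; rewrite -(eqr_nat rat).
  by rewrite (card_setI_layer Ck Dk CD) (card_setI_layer Ak Bk AB).
have [|K cK KP] := sunflower layer_card layer_cardI (layer_gt0 Ak).
  apply: leq_ltn_trans bk.
  by rewrite leq_mul2l leq_exp2r ?(layer_le Ak).
apply/esym/eqP; rewrite eqEcard finset.subsetI !finset.bigcap_inf//=.
by rewrite -cK subset_leq_card//; apply/finset.bigcapsP.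
Qed.

Lemma kernel_sub k A : A \in layer k -> kernel k \subset A.
Proof. by move=> Ak; apply: finset.bigcap_inf. Qed.

Lemma big_m k : big k -> (m < #|layer k|)%N.
Proof. by rewrite /big; nia. Qed.

Lemma card_kernel k : big k -> #|kernel k|%:R = theta * k%:R.
Proof.
move=> bk; have : (1 < #|layer k|)%N.
  have /card_gt0P[A Ak] := leq_ltn_trans (leq0n m) (big_m bk).
  exact: leq_ltn_trans (leq_trans (layer_gt0 Ak) (layer_le Ak)) (big_m bk).
case/card_gt1P => A [B [Ak Bk AB]].
by rewrite -(setI_layer bk Ak Bk AB) (card_setI_layer Ak Bk AB).
Qed.

(** Outside the kernel the members of a big layer are pairwise disjoint, so at most [#|S| <= m] of
    them meet [S] there, fewer than the layer has. *)
Lemma exists_setI_sub_kernel k (S : {set 'I_n}) : big k -> (#|S| <= m)%N ->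
  exists2 A, A \in layer k & A :&: S \subset kernel k.
Proof.
move=> bk Sm.
have [/exists_inP[A Ak AS]|/exists_inPn noA] :=
  boolP [exists A in layer k, A :&: S \subset kernel k]; first by exists A.
pose f (A : {set 'I_n}) := [pick x in (A :&: S) :\: kernel k].
have fP A : A \in layer k -> exists2 x, f A = Some x &
    x \in (A :&: S) :\: kernel k.
  move=> /noA; rewrite /f; case: pickP => [x xP _|no]; first by exists x.
  case/negP; rewrite -finset.setD_eq0; apply/eqP/setP => x.
  by rewrite no finset.in_set0.
have f_inj : {in layer k &, injective f}.
  move=> A B Ak Bk; have [x -> xA] := fP A Ak; have [y -> yB] := fP B Bk.
  move=> -[xy]; rewrite -{}xy in yB; apply/eqP; apply: contraT => AB.
  move: xA yB; rewrite !finset.in_setD !finset.in_setI.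
  move=> /andP[xK /andP[xA _]] /andP[_ /andP[xB _]].
  by rewrite -(setI_layer bk Ak Bk AB) finset.in_setI xA xB in xK.
have : (#|layer k| <= #|S|)%N.
  rewrite -(card_in_imset f_inj) -(card_imset (mem S) (@Some_inj _)).
  apply/subset_leq_card/fintype.subsetP => o /imsetP[A Ak ->].
  have [x -> xA] := fP A Ak; apply/imsetP; exists x => //.
  by move: xA; rewrite finset.in_setD finset.in_setI => /and3P[].
by have := big_m bk; lia.
Qed.

(** A set [A] of layer [j] is chosen to meet [kernel k] only inside [kernel j], then [B] of layer
    [k] to meet [A] only inside [kernel k]. So [A :&: B] lies in both kernels, yet has at least
    [theta * j] points, the size of [kernel j]. *)
Lemma kernel_sub_kernel j k : big j -> big k -> (j < k)%N ->
  kernel j \subset kernel k.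
Proof.
move=> bj bk jk.
have Km : (#|kernel k| <= m)%N.
  have [B Bk] : exists B, B \in layer k.
    by apply/finset.set0Pn; rewrite -card_gt0 (leq_ltn_trans _ (big_m bk)).
  apply: leq_trans (subset_leq_card (kernel_sub Bk)) _.
  by case/layerP: Bk => /F_le.
have [A Aj AK] := exists_setI_sub_kernel bj Km.
have Am : (#|A| <= m)%N by case/layerP: Aj => /F_le.
have [B Bk BA] := exists_setI_sub_kernel bk Am.
have ABK : A :&: B \subset kernel j :&: kernel k.
  rewrite finset.setIC in BA.
  rewrite finset.subsetI BA andbT (fintype.subset_trans _ AK)//.
  by rewrite finset.subsetI subsetIl BA.
have AB : A != B.
  apply: contraTneq jk => eAB; rewrite -leqNgt.
  by case/layerP: Aj => _ <-; case/layerP: Bk => _ <-; rewrite eAB.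
suff : kernel j :&: kernel k == kernel j by move/eqP/finset.setIidPl.
rewrite eqEcard subsetIl /= -(ler_nat rat) card_kernel//.
apply: le_trans (_ : #|A :&: B|%:R <= _); last by rewrite ler_nat subset_leq_card.
case/layerP: Aj => AF Aj; case/layerP: Bk => BF Bk.
case: (F_theta.2 A B AF BF AB) => ->; rewrite ?Aj ?Bk//.
by rewrite ler_pM2l// ler_nat ltnW.
Qed.

Lemma petal_meet j k A B v : big j -> big k -> A \in layer j -> B \in layer k ->
  (j <= k)%N -> v \in A :\: kernel j -> v \in B :\: kernel k ->
  theta * k%:R <= j%:R.
Proof.
move=> bj bk Aj Bk; rewrite leq_eqVlt => /predU1P[-> _ _|jk].
  by rewrite ler_piMl// ltW.
rewrite !finset.in_setD => /andP[vK vA] /andP[_ vB].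
have AB : A != B.
  apply: contraTneq jk => eAB; rewrite -leqNgt.
  by case/layerP: Aj => _ <-; case/layerP: Bk => _ <-; rewrite eAB.
(* [kernel j] lies in [B] through [kernel k]; the extra point [v] rules out [theta * j] as the
   intersection size. *)
have Kv : v |: kernel j \subset A :&: B.
  rewrite finset.subUset finset.sub1set finset.in_setI vA vB finset.subsetI.
  rewrite kernel_sub//= (fintype.subset_trans (kernel_sub_kernel bj bk jk))//.
  exact: kernel_sub.
have := subset_leq_card Kv; rewrite cardsU1 vK add1n -(ler_nat rat) -natr1 card_kernel//.
have : #|A :&: B|%:R <= j%:R :> rat.
  by rewrite ler_nat; case/layerP: (Aj) => _ <-; rewrite subset_leq_card ?subsetIl.
case/layerP: Aj => AF Aj; case/layerP: Bk => BF Bk.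
by case: (F_theta.2 A B AF BF AB) => ->; rewrite ?Aj ?Bk//; lra.
Qed.

(** * Charging sets to the points of their petals *)

Lemma layer_card A : A \in F -> A \in layer #|A|.
Proof. by move=> AF; apply/layerP. Qed.

Definition petals (v : 'I_n) :=
  [set A : {set 'I_n} in F | big #|A| && (v \in A :\: kernel #|A|)].

Lemma petalsP (v : 'I_n) (A : {set 'I_n}) : reflect
  [/\ A \in layer #|A|, big #|A| & v \in A :\: kernel #|A|] (A \in petals v).
Proof.
rewrite [A \in petals v]finset.in_set; apply: (iffP and3P) => -[AF bA vA]; split => //.
  exact: layer_card.
by case/layerP: AF.
Qed.

(** Members of one big layer meet only in the kernel, so the sizes in [petals v] are distinct and
    there are at most [#|A2|] terms, with [A2] the largest set. Each term is at most the inverse of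
    the smallest size [#|A0|], and [petal_meet] bounds [#|A2| / #|A0|]. *)
Lemma sum_petals v : \sum_(A in petals v) #|A|%:R^-1 <= theta^-1.
Proof.
have [->|/finset.set0Pn[A1 A1P]] := eqVneq (petals v) finset.set0.
  by rewrite big_set0 invr_ge0 ltW.
pose A0 := [arg min_(A < A1 in petals v) #|A|]%N.
pose A2 := [arg max_(A > A1 in petals v) #|A|]%N.
have [A0P A0min] : A0 \in petals v /\
    forall A, A \in petals v -> (#|A0| <= #|A|)%N.
  by rewrite /A0; case: arg_minnP.
have [A2P A2max] : A2 \in petals v /\
    forall A, A \in petals v -> (#|A| <= #|A2|)%N.
  by rewrite /A2; case: arg_maxnP.
have [A0l A0b A0v] := petalsP _ _ A0P; have [A2l A2b A2v] := petalsP _ _ A2P.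
have c0 : 0 < #|A0|%:R :> rat by rewrite ltr0n (layer_gt0 A0l).
have c2 : theta * #|A2|%:R <= #|A0|%:R.
  by apply: (petal_meet A0b A2b A0l A2l _ A0v A2v); apply: A0min.
have card_inj : {in petals v &, injective (fun A : {set 'I_n} => #|A|)}.
  move=> A B /petalsP[Al Ab Av] /petalsP[Bl Bb Bv] eAB.
  apply/eqP; apply: contraT => AB; rewrite -eAB in Bl Bv.
  move: Av Bv; rewrite !finset.in_setD => /andP[vK vA] /andP[_ vB].
  by rewrite -(setI_layer Ab Al Bl AB) finset.in_setI vA vB in vK.
have cP : (#|petals v| <= #|A2|)%N.
  have u : uniq [seq #|A| | A : {set 'I_n} <- enum (petals v)].
    rewrite map_inj_in_uniq ?enum_uniq// => A B.
    by rewrite !mem_enum; apply: card_inj.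
  have := uniq_leq_size u (s2 := iota 1 #|A2|).
  rewrite size_map -cardE size_iota; apply => _ /mapP[A + ->].
  rewrite mem_enum mem_iota => AP; rewrite add1n ltnS A2max// andbT.
  by have [/layer_gt0] := petalsP _ _ AP.
apply: (@le_trans _ _ (\sum_(A in petals v) #|A0|%:R^-1)).
  apply: ler_sum => A AP; rewrite lef_pV2 ?posrE// ?ler_nat ?A0min//.
  by rewrite (lt_le_trans c0)// ler_nat A0min.
rewrite sumr_const -[_ *+ _]mulr_natl ler_pdivrMr// mulrC ler_pdivlMr//.
by rewrite (le_trans _ c2)// mulrC ler_pM2l// ler_nat.
Qed.

Lemma card_big_layers :
  #|[set A : {set 'I_n} in F | big #|A|]|%:R <= n%:R / (theta * (1 - theta)).
Proof.
set G := [set _ in _ | _].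
have GP A : A \in G -> A \in layer #|A| /\ big #|A|.
  by rewrite inE => /andP[AF bA]; split => //; apply: layer_card.
have t1 : 0 < 1 - theta by rewrite subr_gt0.
(* The petal of [A] has [(1 - theta) * #|A|] points, so these charges add up to 1 for each set. *)
have -> : #|G|%:R =
    \sum_(A in G) \sum_(v in A :\: kernel #|A|) ((1 - theta) * #|A|%:R)^-1.
  rewrite -sum1_card natr_sum; apply: eq_bigr => A /GP[Al Ab].
  rewrite sumr_const -[RHS]mulr_natl.
  have cA : #|A :\: kernel #|A| |%:R = (1 - theta) * #|A|%:R.
    rewrite cardsD (finset.setIidPr (kernel_sub Al)) natrB ?subset_leq_card ?kernel_sub//.
    by rewrite card_kernel// mulrBl mul1r.
  transitivity ((1 - theta) * #|A|%:R * ((1 - theta) * #|A|%:R)^-1).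
    by apply/esym/divff; rewrite mulf_neq0 ?gt_eqF// ltr0n (layer_gt0 Al).
  by congr (_ * _); exact: esym cA.
have -> : \sum_(A in G) \sum_(v in A :\: kernel #|A|) ((1 - theta) * #|A|%:R)^-1 =
    \sum_v (1 - theta)^-1 * \sum_(A in petals v) #|A|%:R^-1.
  rewrite (exchange_big_dep xpredT)//=; apply: eq_bigr => v _.
  rewrite mulr_sumr; apply: eq_big => [A|A _].
    by rewrite !inE -andbA.
  by rewrite invfM.
apply: le_trans (_ : \sum_(v : 'I_n) (1 - theta)^-1 * theta^-1 <= _).
  by apply: ler_sum => v _; rewrite ler_pM2l ?invr_gt0// sum_petals.
by rewrite sumr_const card_ord -[leLHS]mulr_natl invfM [theta^-1 * _]mulrC.
Qed.

(** * Small layers and the total count *)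

Lemma card_small_layers :
  (#|[set A : {set 'I_n} in F | ~~ big #|A|]| <= 8 * m ^ 3)%N.
Proof.
set G := [set _ in _ | _].
have GP A : A \in G -> A \in layer #|A| /\ ~~ big #|A|.
  by rewrite inE => /andP[AF bA]; split => //; apply: layer_card.
have -> : #|G| = (\sum_(k < m.+1) #|[set A in G | #|A| == k]|)%N.
  rewrite -sum1_card (partition_big (fun A : {set _} => inord #|A| : 'I_m.+1) xpredT)//=.
  apply: eq_bigr => k _; rewrite -sum1_card; apply: eq_bigl => A.
  rewrite [in RHS]inE; apply: andb_id2l => /GP[/layer_le Am _].
  by rewrite -val_eqE /= inordK.
apply: (@leq_trans (\sum_(k < m.+1) 4 * m ^ 2)%N).
  apply: leq_sum => k _; have [bk|] := boolP (big k).
    rewrite (_ : [set _ in _ | _] = finset.set0) ?cards0//.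
    apply/setP => A; rewrite finset.in_set0 inE; apply/negP => /andP[/GP[_ /negP +]].
    by move=> + /eqP Ak; rewrite Ak.
  rewrite -leqNgt; apply: leq_trans; apply/subset_leq_card/fintype.subsetP => A.
  by rewrite inE => /andP[/GP[+ _] /eqP Ak]; rewrite Ak.
(* Sizes from 0 to [m] give [m + 1] layers, and [m + 1 <= 2 * m] for positive [m] turns 4 into 8; at
   [m = 0] both sides vanish. *)
rewrite sum_nat_const card_ord; case: (posnP m) => [->|m0]; first by [].
rewrite (_ : (8 * m ^ 3 = m.*2 * (4 * m ^ 2))%N); last by rewrite -mul2n !expnS; lia.
by rewrite leq_mul2r; apply/orP; right; lia.
Qed.

Lemma card_theta_intersecting :
  #|F|%:R <= 8 * m%:R ^+ 3 + n%:R / (theta * (1 - theta)).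
Proof.
have -> : #|F| = (#|[set A : {set 'I_n} in F | ~~ big #|A|]| +
    #|[set A : {set 'I_n} in F | big #|A|]|)%N.
  rewrite -(cardsID [set A : {set 'I_n} | big #|A|] F) addnC; congr (_ + _)%N.
    by apply: eq_card => A; rewrite !inE andbC.
  by apply: eq_card => A; rewrite !inE.
rewrite natrD lerD ?card_big_layers//.
by rewrite -natrX -natrM ler_nat card_small_layers.
Qed.

End ThetaIntersecting.

(** * From the finite bound to the asymptotic one *)

Unset Implicit Arguments.
Set Strict Implicit.
Local Open Scope classical_set_scope.

Theorem theorem1p5 (R : realType) (theta : rat) (w : nat -> R)
  (theta_gt0 : 0 < theta) (theta_lt1 : theta < 1)
  (w_gt0 : forall n : nat, (0 < n)%N -> 0 < w n)
  (w_bigO : w =O_\oo (fun n : nat => n%:R `^ 3^-1 : R)) :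
  exists2 C : R, 0 < C &
    \forall n \near \oo, forall F : {set {set 'I_n}},
      bounded_family (w n) F -> theta_intersecting theta F ->
      #|F|%:R <= C * n%:R.
Proof.
have /eqO_exP[c c0 wc] := w_bigO.
pose D : rat := (theta * (1 - theta))^-1.
have D0 : 0 < D by rewrite invr_gt0 mulr_gt0 ?subr_gt0.
(* [8 * c ^+ 3] pays for the small layers, where [m] is at most [c] times the cube root of [n], and
   [D] for the big ones. *)
exists (8 * c ^+ 3 + ratr D).
  by rewrite addr_gt0 ?ltr0q// mulr_gt0// exprn_gt0.
near=> n => F wF thF.
have n0 : (0 < n)%N by near: n; exact: nbhs_infty_gt.
have wn0 := w_gt0 _ n0.
(* Set sizes are integers, so the bound [w n] may be replaced by its integer part. *)
pose m := Num.truncn (w n).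
have Fm A : A \in F -> (#|A| <= m)%N.
  by move=> /wF; rewrite /m truncn_ge_nat// ltW.
have mw : m%:R <= w n by rewrite truncn_le// ltW.
have wn : w n <= c * (n%:R `^ 3^-1).
  have : `|w n| <= c * `|n%:R `^ 3^-1| by near: n; exact: wc.
  by rewrite gtr0_norm// ger0_norm// powR_ge0.
have m3 : m%:R ^+ 3 <= c ^+ 3 * n%:R.
  have -> : c ^+ 3 * n%:R = (c * (n%:R `^ 3^-1)) ^+ 3.
    rewrite exprMn; congr (_ * _).
    by rewrite -powR_mulrn ?powR_ge0// -powRrM mulVf// powRr1.
  by apply: lerXn2r; rewrite ?nnegrE// ?mulr_ge0 ?powR_ge0 ?(ltW c0)// (le_trans mw).
have := card_theta_intersecting theta_gt0 theta_lt1 thF Fm.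
rewrite -(ler_rat R) rmorphD /= rmorphM rmorphXn /= [ratr (_ / _)]rmorphM /=.
rewrite !ratr_nat => /le_trans; apply.
by rewrite [leRHS]mulrDl -mulrA lerD// ?ler_pM2l// mulrC.
Unshelve. all: by end_near.
Qed.
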